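(* Let $d,D\ge 1$ be integers, let $\mathcal X\subset\mathbb R^d$ be nonempty with fixed base point $\mathrm e\in\mathcal X$, and let $L\ge 2$ be an integer. Let $R_L:\mathrm{Lip}(\mathcal X;\mathbb R^D)\to[0,+\infty]$ be the extended representation cost of depth-$L$ ReLU networks with weight decay, and let $\mathcal F_L=\{f\in \mathrm{Lip}(\mathcal X;\mathbb R^D): R_L(f)<+\infty\}$ be its native space. Then $R_L^{L/2}$ is a $(2/L)$-seminorm (on $\mathcal F_L$). Furthermore, $\mathcal F_L$ is a $(2/L)$-normed quasi-Banach space under the quasi-norm $$\|f\|_{\mathcal F_L}:=\max\{R_L(f)^{L/2},\ \|f(\mathrm e)\|_2\};$$ that is, $\|\cdot\|_{\mathcal F_L}$ is a $(2/L)$-norm on $\mathcal F_L$ and $\mathcal F_L$ is complete with respect to it.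
   Context: **Lipschitz space and weak\* topology.** $\mathcal X\subset\mathbb R^d$ carries the Euclidean metric. $\mathrm{Lip}(\mathcal X;\mathbb R^D)$ is the space of Lipschitz maps $f:\mathcal X\to\mathbb R^D$, with norm $\max\{|f|_{\mathrm{Lip}},\|f(\mathrm e)\|_2\}$, $|f|_{\mathrm{Lip}}=\sup_{x\ne y}\|f(x)-f(y)\|_2/\|x-y\|_2$. The Arens–Eells space $\mathrm{AE}(\mathcal X)$ is the completion of the span of $\{\delta_x-\delta_y:x,y\in\mathcal X\}$ under $\|m\|=\inf\{\sum_i|a_i|\,\|x_i-y_i\|_2: m=\sum_i a_i(\delta_{x_i}-\delta_{y_i})\}$; it is the predual of the scalar Lipschitz functions vanishing at $\mathrm e$, via $\langle\sum_i a_i(\delta_{x_i}-\delta_{y_i}),g\rangle=\sum_i a_i(g(x_i)-g(y_i))$. $\mathrm{Lip}(\mathcal X;\mathbb R^D)$ is isometrically the dual of $(\mathrm{AE}(\mathcal X)\widehat\otimes_\pi\mathbb R^D)\oplus_1\mathbb R^D$, and $w^*$ is the corresponding weak\* topology: the coarsest topology making $f\mapsto\langle m,f_j-f_j(\mathrm e)\rangle$ and $f\mapsto f_j(\mathrm e)$ continuous for all components $j$ and all $m\in \mathrm{AE}(\mathcal X)$. **Lower semicontinuous regularization.** A function $K$ on a topological space with values in $[-\infty,+\infty]$ is l.s.c. if all sublevel sets $\{K\le\alpha\}$, $\alpha\in\mathbb R$, are closed. Its l.s.c. regularization is the largest l.s.c. function bounded above by $K$. **Deep ReLU networks.** $\Theta_L$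 is the set of tuples $\theta=((W_1,b_1),\dots,(W_L,b_L))$ with $W_\ell\in\mathbb R^{K_{\ell+1}\times K_\ell}$, $b_\ell\in\mathbb R^{K_{\ell+1}}$, $K_1=d$, $K_{L+1}=D$, and arbitrary finite hidden widths $K_2,\dots,K_L\in\mathbb N$. Set $f_\theta=a_L\circ\sigma\circ a_{L-1}\circ\cdots\circ\sigma\circ a_1$ restricted to $\mathcal X$, $a_\ell(z)=W_\ell z+b_\ell$, $\sigma=\max\{0,\cdot\}$ entrywise. The parameter cost is $C_L(\theta)=\frac1L\sum_{\ell=1}^L\|W_\ell\|_F^2$. Define $R_{\Theta_L}(f)=\inf\{C_L(\theta):\theta\in\Theta_L,\ f_\theta=f\}$ for $f\in\mathrm{Lip}(\mathcal X;\mathbb R^D)$ ($\inf\varnothing=+\infty$). $R_L$ is the $w^*$-l.s.c. regularization of $R_{\Theta_L}$ on $\mathrm{Lip}(\mathcal X;\mathbb R^D)$. **Quasi-norms.** A quasi-seminorm $Q$ on a real vector space is a $[0,\infty)$-valued absolutely $1$-homogeneous function ($Q(\alpha f)=|\alpha|Q(f)$) with $Q(f+g)\le c(Q(f)+Q(g))$ for some constant $c$; it is a quasi-norm if also $Q(f)=0\Rightarrow f=0$. For $0<p\le1$, a $p$-seminorm is a quasi-seminorm with $Q(f+g)^p\le Q(f)^p+Q(g)^p$; a $p$-norm is a $p$-seminorm that is a quasi-norm. A quasi-Banach space is a complete quasi-normed space. *)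

(* Defs.v *)
From HB Require Import structures.
From mathcomp Require Import all_boot all_order all_algebra.
From mathcomp Require Import all_classical all_reals all_analysis.
From mathcomp Require Import ring lra.

Set Implicit Arguments.
Unset Strict Implicit.
Unset Printing Implicit Defensive.

Import Order.TTheory GRing.Theory Num.Theory.
Import numFieldNormedType.Exports.

Local Open Scope classical_set_scope.
Local Open Scope ring_scope.

(* The library norm on matrices is the sup norm, not the Euclidean one. *)
Definition enorm (R : realType) (n : nat) (v : 'cV[R]_n) : R :=
  Num.sqrt (\sum_i v i 0 ^+ 2).

Section EnormTheory.
Context (R : realType) (n : nat).
Implicit Types v w : 'cV[R]_n.

Lemma enorm_ge0 v : 0 <= enorm v.
Proof. exact: sqrtr_ge0. Qed.

Lemma sqr_enorm v : enorm v ^+ 2 = \sum_i v i 0 ^+ 2.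
Proof. by rewrite sqr_sqrtr// sumr_ge0// => i _; rewrite sqr_ge0. Qed.

Lemma enorm0 : enorm (0 : 'cV[R]_n) = 0.
Proof. by rewrite /enorm big1 ?sqrtr0// => i _; rewrite mxE expr0n. Qed.

Lemma enorm0_eq0 v : enorm v = 0 -> v = 0.
Proof.
move=> /(congr1 (fun x => x ^+ 2)); rewrite sqr_enorm expr0n /= => /eqP.
rewrite psumr_eq0; last by move=> i _; rewrite sqr_ge0.
move=> /allP v0; apply/matrixP => i j; rewrite ord1 mxE.
by apply/eqP; have := v0 i (mem_index_enum _); rewrite sqrf_eq0.
Qed.

Lemma enormZ a v : enorm (a *: v) = `|a| * enorm v.
Proof.
rewrite /enorm -sqrtr_sqr -sqrtrM ?sqr_ge0// mulr_sumr; congr Num.sqrt.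
by apply: eq_bigr => i _; rewrite mxE exprMn.
Qed.

Lemma enorm_dot v w : \sum_i v i 0 * w i 0 <= enorm v * enorm w.
Proof.
have [/enorm0_eq0 ->|v0] := eqVneq (enorm v) 0.
  by rewrite enorm0 mul0r big1// => i _; rewrite mxE mul0r.
have [/enorm0_eq0 ->|w0] := eqVneq (enorm w) 0.
  by rewrite enorm0 mulr0 big1// => i _; rewrite mxE mulr0.
have vw : 0 < enorm v * enorm w by rewrite mulr_gt0// lt0r ?v0 ?w0 enorm_ge0.
have : 0 <= \sum_i (enorm w * v i 0 - enorm v * w i 0) ^+ 2.
  by apply: sumr_ge0 => i _; rewrite sqr_ge0.
have -> : \sum_i (enorm w * v i 0 - enorm v * w i 0) ^+ 2 =
    enorm w ^+ 2 * (\sum_i v i 0 ^+ 2) + enorm v ^+ 2 * (\sum_i w i 0 ^+ 2)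
    - 2 * (enorm v * enorm w) * (\sum_i v i 0 * w i 0).
  by rewrite !mulr_sumr -sumrN -!big_split/=; apply: eq_bigr => i _; ring.
rewrite -!sqr_enorm => h; rewrite -(ler_pM2l vw); lra.
Qed.

Lemma enormD v w : enorm (v + w) <= enorm v + enorm w.
Proof.
rewrite -(@ler_pXn2r _ 2)// ?nnegrE ?addr_ge0 ?enorm_ge0//.
have -> : enorm (v + w) ^+ 2 =
    enorm v ^+ 2 + enorm w ^+ 2 + 2 * (\sum_i v i 0 * w i 0).
  rewrite !sqr_enorm mulr_sumr -!big_split/=; apply: eq_bigr => i _.
  by rewrite mxE; ring.
have := enorm_dot v w; lra.
Qed.

End EnormTheory.

Section LipschitzSpace.
Context (R : realType) (d : nat) (X : set 'cV[R]_d) (D : nat).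

Definition lipschitz_fun : set (X -> 'cV[R]_D) :=
  [set f | exists k, forall x y, enorm (f x - f y) <= k * enorm (val x - val y)].

Definition lipschitz_pred : {pred (X -> 'cV[R]_D)} :=
  [pred f | f \in lipschitz_fun].

Lemma lipschitz_submod_closed : submod_closed lipschitz_pred.
Proof.
split.
  rewrite !inE; exists 0 => x y.
  by rewrite subrr enorm0 mul0r.
move=> a f g; rewrite !inE => -[k fk] [l gl]; exists (`|a| * k + l) => x y.
rewrite (_ : _ - _ = a *: (f x - f y) + (g x - g y)); last first.
  by rewrite scalerBr opprD addrACA.
rewrite (le_trans (enormD _ _))// enormZ mulrDl -mulrA lerD//.
exact: ler_wpM2l.
Qed.

HB.instance Definition _ :=
  GRing.isSubmodClosed.Build R (X -> 'cV[R]_D) lipschitz_pred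
    lipschitz_submod_closed.

Record Lip := MkLip {
  lip_fun :> X -> 'cV[R]_D;
  lip_funP : lip_fun \in lipschitz_pred }.

HB.instance Definition _ := [isSub for lip_fun].
HB.instance Definition _ := [Choice of Lip by <:].
HB.instance Definition _ := [SubChoice_isSubLmodule of Lip by <:].

End LipschitzSpace.
Arguments Lip {R d} X D.

Section ArensEells.
Context (R : realType) (d : nat) (X : set 'cV[R]_d).

(* [:: (a_1, x_1, y_1); ...] stands for the formal sum
   \sum_i a_i (delta_{x_i} - delta_{y_i}); distinct formal sums can denote the
   same element of the span of the delta_x - delta_y, namely when they have the
   same [mol_fun]. *)
Definition molecule := seq (R * X * X).

Definition mol_fun (m : molecule) (z : X) : R :=
  \sum_(t <- m) t.1.1 * ((z == t.1.2)%:R - (z == t.2)%:R).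

Definition mol_cost (m : molecule) : R :=
  \sum_(t <- m) `|t.1.1| * enorm (val t.1.2 - val t.2).

Definition mol_pairing (m : molecule) (g : X -> R) : R :=
  \sum_(t <- m) t.1.1 * (g t.1.2 - g t.2).

Definition ae_norm (h : X -> R) : R :=
  inf [set mol_cost m | m in [set m | mol_fun m = h]].

Definition ae_cauchy (u : nat -> molecule) : Prop :=
  forall eps : R, 0 < eps -> exists N, forall p q, (N <= p)%N -> (N <= q)%N ->
    ae_norm (mol_fun (u p) - mol_fun (u q)) < eps.

(* An element of the completion is presented by a Cauchy sequence. Cauchy
   sequences are not quotiented by null sequences: equivalent ones have the same
   pairing with every Lipschitz function, see [eq_ae_pairing]. *)
Record AE := MkAE {
  ae_seq :> nat -> molecule;
  ae_seqP : ae_cauchy ae_seq }.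

(* The limit exists when g is Lipschitz, see [is_cvg_ae_pairing]. *)
Definition ae_pairing (m : AE) (g : X -> R) : R :=
  limn (fun n => mol_pairing (m n) g).

Lemma mol_pairingE (m : molecule) (g : X -> R) (s : seq X) :
  uniq s -> (forall t, t \in m -> (t.1.2 \in s) && (t.2 \in s)) ->
  mol_pairing m g = \sum_(z <- s) mol_fun m z * g z.
Proof.
move=> us ms; rewrite /mol_fun.
under eq_bigr do rewrite mulr_suml.
rewrite exchange_big/= /mol_pairing; apply: eq_big_seq => t /ms/andP[t1 t2].
under eq_bigr => z _ do rewrite -mulrA mulrBl.
rewrite -mulr_sumr sumrB; congr (_ * (_ - _)).
- rewrite (bigD1_seq t.1.2)//= eqxx mul1r big1 ?addr0// => z /negbTE->.
  by rewrite mul0r.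
- rewrite (bigD1_seq t.2)//= eqxx mul1r big1 ?addr0// => z /negbTE->.
  by rewrite mul0r.
Qed.

Lemma eq_mol_pairing (m n : molecule) (g : X -> R) :
  mol_fun m = mol_fun n -> mol_pairing m g = mol_pairing n g.
Proof.
move=> mn; pose s :=
  undup ([seq t.1.2 | t <- m ++ n] ++ [seq t.2 | t <- m ++ n]).
have us : uniq s by exact: undup_uniq.
have H t : t \in m ++ n -> (t.1.2 \in s) && (t.2 \in s).
  move=> tm; rewrite !mem_undup !mem_cat.
  by rewrite (map_f (fun t => t.1.2) tm) (map_f (fun t => t.2) tm) orbT.
rewrite !(@mol_pairingE _ _ s)// ?mn// => t tm; apply: H.
all: by rewrite mem_cat tm ?orbT.
Qed.

Lemma mol_pairing_le (m : molecule) (g : X -> R) (k : R) :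
  (forall x y, `|g x - g y| <= k * enorm (val x - val y)) ->
  `|mol_pairing m g| <= k * mol_cost m.
Proof.
move=> gk; rewrite (le_trans (ler_norm_sum _ _ _))// mulr_sumr ler_sum// => t _.
by rewrite normrM mulrCA ler_wpM2l.
Qed.

Definition mol_opp (m : molecule) : molecule :=
  [seq (- t.1.1, t.1.2, t.2) | t <- m].

Lemma mol_funB (m n : molecule) :
  mol_fun (m ++ mol_opp n) = mol_fun m - mol_fun n.
Proof.
apply/funext => z; rewrite /mol_fun big_cat big_map/= -[RHS]/(_ + _)/=; congr (_ + _).
by rewrite -[RHS]/(- _) -sumrN; apply: eq_bigr => t _; rewrite mulNr.
Qed.

Lemma mol_pairingB (m n : molecule) g :
  mol_pairing (m ++ mol_opp n) g = mol_pairing m g - mol_pairing n g.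
Proof.
rewrite /mol_pairing big_cat big_map/=; congr (_ + _).
by rewrite -sumrN; apply: eq_bigr => t _; rewrite mulNr.
Qed.

Lemma mol_pairing_lt (m n : molecule) (g : X -> R) (k eps : R) :
  0 < k ->
  (forall x y, `|g x - g y| <= k * enorm (val x - val y)) ->
  ae_norm (mol_fun m - mol_fun n) < eps ->
  `|mol_pairing m g - mol_pairing n g| < k * eps.
Proof.
move=> k0 gk; rewrite /ae_norm => /inf_lt [|c [r rE <-] ceps].
  by exists (mol_cost (m ++ mol_opp n)), (m ++ mol_opp n) => //=; rewrite mol_funB.
rewrite -mol_pairingB (eq_mol_pairing (n := r)); last by rewrite mol_funB rE.
by rewrite (le_lt_trans (mol_pairing_le _ gk))// ltr_pM2l.
Qed.

Lemma lipschitz_pos (g : X -> R) (k : R) :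
  (forall x y, `|g x - g y| <= k * enorm (val x - val y)) ->
  0 < `|k| + 1 /\ forall x y, `|g x - g y| <= (`|k| + 1) * enorm (val x - val y).
Proof.
move=> gk; split=> [|x y]; first by rewrite ltr_wpDl.
rewrite (le_trans (gk x y))// ler_wpM2r ?enorm_ge0// (le_trans (ler_norm k))//.
by rewrite lerDl.
Qed.

Lemma is_cvg_ae_pairing (m : AE) (g : X -> R) (k : R) :
  (forall x y, `|g x - g y| <= k * enorm (val x - val y)) ->
  cvgn (fun n => mol_pairing (m n) g).
Proof.
move=> /lipschitz_pos[k0 gk]; apply: cauchy_cvg; apply/cauchy_exP => eps eps0.
have [N HN] := ae_seqP m (divr_gt0 eps0 k0).
exists (mol_pairing (m N) g); exists N => // n /= Nn.
have := mol_pairing_lt k0 gk (HN _ _ (leqnn N) Nn).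
by rewrite mulrCA mulfV ?gt_eqF// mulr1.
Qed.

Lemma eq_ae_pairing (u v : AE) (g : X -> R) (k : R) :
  (forall x y, `|g x - g y| <= k * enorm (val x - val y)) ->
  ae_norm (mol_fun (u n) - mol_fun (v n)) @[n --> \oo] --> 0 ->
  ae_pairing u g = ae_pairing v g.
Proof.
move=> gk uv; have [k0 gk'] := lipschitz_pos gk.
have cu := is_cvg_ae_pairing (m := u) gk; have cv := is_cvg_ae_pairing (m := v) gk.
apply/eqP; rewrite -subr_eq0 /ae_pairing -(limB cu cv).
apply/eqP; apply: cvg_lim => //; apply/cvgr0Pnorm_lt => eps eps0.
have /cvgr_lt/(_ _ (divr_gt0 eps0 k0)) := uv; apply: filterS => n /=.
by move/(mol_pairing_lt k0 gk'); rewrite mulrCA mulfV ?gt_eqF// mulr1.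
Qed.

End ArensEells.
Arguments AE {R d} X.

Section WeakStar.
Context (R : realType) (d : nat) (X : set 'cV[R]_d) (e : X) (D : nat).

(* [inl (j, m)] : f |-> <m, f_j - f_j(e)>;  [inr j] : f |-> f_j(e) *)
Definition wstar_eval (i : 'I_D * AE X + 'I_D) (f : Lip X D) : R :=
  match i with
  | inl (j, m) => ae_pairing m (fun x => f x j 0 - f e j 0)
  | inr j => f e j 0
  end.

(* The space [Lip X D] with the coarsest topology making all the maps
   [wstar_eval i] continuous. *)
Definition wstarLip := sup_topology
  (fun i => Topological.class (initial_topology (wstar_eval i))).

HB.instance Definition _ := Topological.on wstarLip.

End WeakStar.
Arguments wstarLip {R d X} e D.

Section LowerSemicontinuity.
Context (R : realType) (T : topologicalType).
Implicit Types K G : T -> \bar R.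

Definition lsc K : Prop :=
  forall a : R, closed [set x | (K x <= a%:E)%E].

(* The largest lower semicontinuous function below K: see [lsc_lsc_reg],
   [lsc_reg_le] and [lsc_reg_max]. *)
Definition lsc_reg K (x : T) : \bar R :=
  ereal_sup [set G x | G in [set G | lsc G /\ forall y, (G y <= K y)%E]].

Lemma lsc_reg_le K x : (lsc_reg K x <= K x)%E.
Proof. by apply: ge_ereal_sup => _ [G [_ GK] <-]. Qed.

Lemma lsc_reg_max K G : lsc G -> (forall y, (G y <= K y)%E) ->
  forall x, (G x <= lsc_reg K x)%E.
Proof. by move=> lG GK x; apply: ereal_sup_ubound; exists G. Qed.

Lemma lsc_lsc_reg K : lsc (lsc_reg K).
Proof.
move=> a; rewrite (_ : [set _ | _] = \bigcap_(G in
    [set G : T -> \bar R | lsc G /\ forall y, (G y <= K y)%E])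
    [set x | (G x <= a%:E)%E]); last first.
  apply/seteqP; split=> [x /= Ka G [lG GK]|x /= Ga].
    by apply: le_trans Ka; exact: lsc_reg_max.
  by apply: ge_ereal_sup => _ [G lG <-]; exact: Ga.
by apply: closed_bigI => G [lG _]; exact: lG.
Qed.

End LowerSemicontinuity.

Section ReLUNetworks.
Context (R : realType) (D : nat).

(* [relu_net L k]: parameters of the depth-[L] networks with input dimension
   [k] and output dimension [D]; the hidden widths are existentially bound in
   the constructor [Hidden]. There is no network of depth 0. *)
Inductive relu_net : nat -> nat -> Type :=
| Output k of 'M[R]_(D, k) & 'cV[R]_D : relu_net 1 k
| Hidden L k h of 'M[R]_(h, k) & 'cV[R]_h & relu_net L h : relu_net L.+1 k.

Definition relu (n : nat) (z : 'cV[R]_n) : 'cV[R]_n := map_mx (Num.max 0) z.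

Fixpoint realize L k (theta : relu_net L k) : 'cV[R]_k -> 'cV[R]_D :=
  match theta with
  | Output _ W b => fun z => W *m z + b
  | Hidden _ _ _ W b theta' => fun z => realize theta' (relu (W *m z + b))
  end.

Definition frobenius_sq m n (W : 'M[R]_(m, n)) : R :=
  \sum_i \sum_j W i j ^+ 2.

Fixpoint weight_sq L k (theta : relu_net L k) : R :=
  match theta with
  | Output _ W _ => frobenius_sq W
  | Hidden _ _ _ W _ theta' => frobenius_sq W + weight_sq theta'
  end.

Definition param_cost L k (theta : relu_net L k) : R :=
  L%:R^-1 * weight_sq theta.

Lemma param_cost_ge0 L k (theta : relu_net L k) : 0 <= param_cost theta.
Proof.
rewrite mulr_ge0 ?invr_ge0 ?ler0n//.
have F m n (W : 'M[R]_(m, n)) : 0 <= frobenius_sq W.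
  by apply: sumr_ge0 => i _; apply: sumr_ge0 => j _; rewrite sqr_ge0.
by elim: theta => [*|? ? ? W b t IH] /=; rewrite ?addr_ge0.
Qed.

End ReLUNetworks.

Section RepresentationCost.
Context (R : realType) (d : nat) (X : set 'cV[R]_d) (e : X) (D L : nat).

Definition RTheta (f : Lip X D) : \bar R :=
  ereal_inf [set (param_cost theta)%:E | theta in
    [set theta : relu_net R D L d | (fun x : X => realize theta (val x)) = f]].

Definition RL : Lip X D -> \bar R := lsc_reg (RTheta : wstarLip e D -> \bar R).

Lemma RL_ge0 f : (0 <= RL f)%E.
Proof.
apply: (@lsc_reg_max R (wstarLip e D) _ (cst 0%E)) => [a|g].
  have [a0|a0] := leP 0 a; last first.
    rewrite (_ : [set _ | _] = set0); first exact: closed0.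
    by apply/seteqP; split=> x //=; rewrite lee_fin leNgt a0.
  rewrite (_ : [set _ | _] = setT); first exact: closedT.
  by apply/seteqP; split=> x //=; rewrite lee_fin a0.
by apply: le_ereal_inf_tmp => _ [theta _ <-]; rewrite lee_fin param_cost_ge0.
Qed.

Definition native_space : set (Lip X D) := [set f | (RL f < +oo)%E].

(* [fine] loses nothing on [native_space], where [0 <= RL f < +oo]. *)
Definition RL_pow (f : Lip X D) : R := fine (RL f) `^ (L%:R / 2).

Definition native_norm (f : Lip X D) : R := Num.max (RL_pow f) (enorm (f e)).

End RepresentationCost.
Arguments native_space {R d X} e D L.
Arguments RL_pow {R d X} e {D} L.
Arguments native_norm {R d X} e {D} L.

(* Quasi-norms on a linear subspace [V] of [E]; values outside [V] are
   irrelevant. *)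
Section QuasiNorms.
Context (R : realType) (E : lmodType R).
Implicit Types (V : set E) (Q : E -> R) (p : R).

Definition quasi_seminorm V Q : Prop :=
  [/\ submod_closed (mem V),
      forall f, V f -> 0 <= Q f,
      forall a f, V f -> Q (a *: f) = `|a| * Q f &
      exists c, forall f g, V f -> V g -> Q (f + g) <= c * (Q f + Q g)].

Definition quasi_norm V Q : Prop :=
  quasi_seminorm V Q /\ forall f, V f -> Q f = 0 -> f = 0.

Definition p_seminorm p V Q : Prop :=
  [/\ 0 < p <= 1, quasi_seminorm V Q &
      forall f g, V f -> V g -> Q (f + g) `^ p <= Q f `^ p + Q g `^ p].

Definition p_norm p V Q : Prop := p_seminorm p V Q /\ quasi_norm V Q.

Definition quasi_complete V Q : Prop :=
  forall u : nat -> E, (forall n, V (u n)) ->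
    (forall eps : R, 0 < eps -> exists N, forall m n, (N <= m)%N -> (N <= n)%N ->
      Q (u m - u n) < eps) ->
    exists2 f, V f & Q (u n - f) @[n --> \oo] --> 0.

Definition quasi_Banach V Q : Prop := quasi_norm V Q /\ quasi_complete V Q.

End QuasiNorms.

(* Main.v *)
Require Import Defs.
From mathcomp Require Import all_boot all_order all_algebra.
From mathcomp Require Import all_classical all_reals all_analysis.
From mathcomp Require Import ring lra.

(** Networks of depth [L] can be rescaled ([c] in every weight multiplies the
    realization by [c ^+ L] and the cost by [c ^+ 2]) and run in parallel, so
    [RTheta] is [2/L]-homogeneous and subadditive. Translations and dilations are
    weak* continuous, hence the largest lower semicontinuous minorant [RL]
    inherits both properties: a lower semicontinuous function of [f] bounded by
    [RTheta f] up to an affine change is bounded by [RL f] up to the same change.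
    The Lipschitz constant of a network is controlled by its cost and is weak*
    lower semicontinuous, so [RL] controls it too; this gives definiteness, and
    shows that a Cauchy sequence [u] of the native space converges to some [f] in
    the Lipschitz norm, hence weak*. As the sublevel sets of [RL] are closed, a
    bound on [RL (u n - u m)] for all large [m] passes to [RL (u n - f)]. *)

Set Implicit Arguments.
Unset Strict Implicit.
Unset Printing Implicit Defensive.

Import Order.TTheory GRing.Theory Num.Theory.
Import numFieldNormedType.Exports.

Local Open Scope classical_set_scope.
Local Open Scope ring_scope.

(** * Lipschitz bounds, rescaling, negation and sums of networks *)

Section Networks.
Context (R : realType) (D : nat).
Implicit Types (L k : nat).

Lemma frobenius_sq_ge0 m n (W : 'M[R]_(m, n)) : 0 <= frobenius_sq W.
Proof. by apply: sumr_ge0 => i _; apply: sumr_ge0 => j _; rewrite sqr_ge0. Qed.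

Lemma weight_sq_ge0 L k (t : relu_net R D L k) : 0 <= weight_sq t.
Proof.
by elim: t => [*|? ? ? W b t IH] /=; rewrite ?addr_ge0// frobenius_sq_ge0.
Qed.

Lemma frobenius_sqZ m n c (W : 'M[R]_(m, n)) :
  frobenius_sq (c *: W) = c ^+ 2 * frobenius_sq W.
Proof.
rewrite /frobenius_sq mulr_sumr; apply: eq_bigr => i _.
by rewrite mulr_sumr; apply: eq_bigr => j _; rewrite mxE exprMn.
Qed.

Lemma frobenius_sq0 m n : frobenius_sq (0 : 'M[R]_(m, n)) = 0.
Proof. by rewrite -[0](scale0r 0) frobenius_sqZ expr0n mul0r. Qed.

Lemma frobenius_sq_row m n1 n2 (A : 'M[R]_(m, n1)) (B : 'M[R]_(m, n2)) :
  frobenius_sq (row_mx A B) = frobenius_sq A + frobenius_sq B.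
Proof.
rewrite /frobenius_sq -big_split; apply: eq_bigr => i _ /=.
rewrite big_split_ord /=.
by congr (_ + _); apply: eq_bigr => j _; rewrite ?row_mxEl ?row_mxEr.
Qed.

Lemma frobenius_sq_col m1 m2 n (A : 'M[R]_(m1, n)) (B : 'M[R]_(m2, n)) :
  frobenius_sq (col_mx A B) = frobenius_sq A + frobenius_sq B.
Proof.
rewrite /frobenius_sq big_split_ord /=.
by congr (_ + _); apply: eq_bigr => i _; apply: eq_bigr => j _;
  rewrite ?col_mxEu ?col_mxEd.
Qed.

Lemma frobenius_sq_block m1 m2 n1 n2 (A : 'M[R]_(m1, n1)) (B : 'M[R]_(m2, n2)) :
  frobenius_sq (block_mx A 0 0 B) = frobenius_sq A + frobenius_sq B.
Proof.
by rewrite frobenius_sq_col !frobenius_sq_row !frobenius_sq0 addr0 add0r.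
Qed.

Lemma relu_col m n (a : 'cV[R]_m) (b : 'cV[R]_n) :
  relu (col_mx a b) = col_mx (relu a) (relu b).
Proof. by rewrite /relu map_col_mx. Qed.

Lemma reluZ n c (a : 'cV[R]_n) : 0 <= c -> relu (c *: a) = c *: relu a.
Proof.
by move=> c0; apply/matrixP => i j; rewrite !mxE maxr_pMr// mulr0.
Qed.

Lemma enorm_relu n (a b : 'cV[R]_n) : enorm (relu a - relu b) <= enorm (a - b).
Proof.
rewrite ler_wsqrtr// ler_sum// => i _; rewrite !mxE.
set x := a i 0; set y := b i 0.
by have [x0|x0] := leP x 0; have [y0|y0] := leP y 0;
  [rewrite subrr expr0n sqr_ge0 | nra..].
Qed.

(** Cauchy-Schwarz on each row of [W]. *)
Lemma enorm_mulmx m n (W : 'M[R]_(m, n)) (v : 'cV[R]_n) :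
  enorm (W *m v) <= Num.sqrt (frobenius_sq W) * enorm v.
Proof.
rewrite -sqrtrM ?frobenius_sq_ge0// ler_wsqrtr// mulr_suml ler_sum// => i _.
pose w : 'cV[R]_n := \col_j W i j.
have -> : (W *m v) i 0 = \sum_j w j 0 * v j 0.
  by rewrite mxE; apply: eq_bigr => j _; rewrite mxE.
have -> : \sum_j W i j ^+ 2 = enorm w ^+ 2.
  by rewrite sqr_enorm; apply: eq_bigr => j _; rewrite mxE.
rewrite -sqr_enorm -exprMn -[leLHS]real_normK ?num_real//.
rewrite lerXn2r ?nnegrE ?mulr_ge0 ?enorm_ge0//.
(* [enorm_dot] only bounds from above; the lower bound is its instance at [- w]. *)
rewrite ler_norml enorm_dot andbT lerNl -sumrN.
have := enorm_dot (- w) v; rewrite -scaleN1r enormZ normrN1 mul1r.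
apply: le_trans; apply: ler_sum => j _; rewrite !mxE; lra.
Qed.

(* The product of the Frobenius norms is a Lipschitz constant; this crude upper
   bound for it spares AM-GM, as only its homogeneity matters. *)
Lemma realize_lipschitz L k (t : relu_net R D L k) x y :
  enorm (realize t x - realize t y) <=
    Num.sqrt (weight_sq t) ^+ L * enorm (x - y).
Proof.
elim: t x y => [{}k W b|{}L {}k h W b t IH] x y /=.
  by rewrite opprD addrACA subrr addr0 -mulmxBr expr1 enorm_mulmx.
apply: (le_trans (IH _ _)); rewrite exprSr -mulrA.
apply: ler_pM; rewrite ?exprn_ge0 ?sqrtr_ge0 ?enorm_ge0//.
  by rewrite lerXn2r ?nnegrE ?sqrtr_ge0// ler_wsqrtr// lerDr frobenius_sq_ge0.
apply: (le_trans (enorm_relu _ _)).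
rewrite opprD addrACA subrr addr0 -mulmxBr (le_trans (enorm_mulmx _ _))//.
by rewrite ler_wpM2r ?enorm_ge0// ler_wsqrtr// lerDl weight_sq_ge0.
Qed.

(** [s] is the factor already accumulated on the input of the current layer: to stay proportional to
    [W *m z], the bias is multiplied by [c * s], the weights by [c] alone. *)
Fixpoint scale_net (c s : R) L k (t : relu_net R D L k) : relu_net R D L k :=
  match t with
  | Output _ W b => Output (c *: W) ((c * s) *: b)
  | Hidden _ _ _ W b t' => Hidden (c *: W) ((c * s) *: b) (scale_net c (c * s) t')
  end.

Lemma weight_sq_scale c s L k (t : relu_net R D L k) :
  weight_sq (scale_net c s t) = c ^+ 2 * weight_sq t.
Proof.
by elim: t s => [{}k W b|{}L {}k h W b t IH] s /=;
  rewrite frobenius_sqZ// IH mulrDr.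
Qed.

Lemma realize_scale c s L k (t : relu_net R D L k) z : 0 <= c -> 0 <= s ->
  realize (scale_net c s t) (s *: z) = (c ^+ L * s) *: realize t z.
Proof.
move=> c0; elim: t s z => [{}k W b|{}L {}k h W b t IH] s z s0 /=.
  by rewrite -scalemxAl -scalemxAr scalerA -scalerDr expr1.
rewrite -scalemxAl -scalemxAr scalerA -scalerDr reluZ ?mulr_ge0//.
by rewrite IH ?mulr_ge0// mulrA -exprSr.
Qed.

(** [relu] commutes only with nonnegative factors, so the sign goes into the output layer. *)
Fixpoint opp_net L k (t : relu_net R D L k) : relu_net R D L k :=
  match t with
  | Output _ W b => Output (- W) (- b)
  | Hidden _ _ _ W b t' => Hidden W b (opp_net t')
  end.

Lemma weight_sq_opp L k (t : relu_net R D L k) :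
  weight_sq (opp_net t) = weight_sq t.
Proof.
elim: t => [{}k W b|{}L {}k h W b t IH] /=; last by rewrite IH.
by rewrite -scaleN1r frobenius_sqZ sqrrN expr1n mul1r.
Qed.

Lemma realize_opp L k (t : relu_net R D L k) z :
  realize (opp_net t) z = - realize t z.
Proof.
elim: t z => [{}k W b|{}L {}k h W b t IH] z /=; last by rewrite IH.
by rewrite mulNmx opprD.
Qed.

(** Inversion for the indexed family. At depth 1 the type still allows [Hidden] over a tail of depth
    0, a branch that [relu_net0] later discards. *)
Lemma relu_netP L k (t : relu_net R D L k) :
  match L return relu_net R D L k -> Prop with
  | 0 => fun=> False
  | 1 => fun t => (exists W b, t = Output W b) \/
      (exists h (W : 'M[R]_(h, k)) b t', t = Hidden W b t')
  | L'.+1 => fun t => exists h (W : 'M[R]_(h, k)) b t', t = Hidden W b t'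
  end t.
Proof.
case: t => [{}k W b|{}L {}k h W b t] /=; first by left; exists W, b.
by case: L t => [|L] t; [right|]; exists h, W, b, t.
Qed.

Lemma relu_net0 k (t : relu_net R D 0 k) : False.
Proof. exact: (relu_netP t). Qed.

(** Block diagonal hidden layers keep the two networks independent, and output layers placed side by
    side add the results; the zero blocks cost nothing. *)
Lemma parallel_net L k1 k2 (t1 : relu_net R D L k1) (t2 : relu_net R D L k2) :
  exists t : relu_net R D L (k1 + k2),
    weight_sq t = weight_sq t1 + weight_sq t2 /\
    forall z1 z2, realize t (col_mx z1 z2) = realize t1 z1 + realize t2 z2.
Proof.
elim: t1 k2 t2 => [{}k1 W b|{}L {}k1 h W b t IH] k2 t2; last first.
  case: L t IH t2 => [t|L t IH t2]; first by case: (relu_net0 t).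
  have [h2 [W2 [b2 [t' ->]]]] := relu_netP t2.
  have [s [sw sE]] := IH _ t'.
  exists (Hidden (block_mx W 0 0 W2) (col_mx b b2) s); split=> [|z1 z2] /=.
    by rewrite frobenius_sq_block sw addrACA.
  by rewrite mul_block_col !mul0mx addr0 add0r add_col_mx relu_col sE.
have [[W2 [b2 ->]]|[h [? [? [t _]]]]] := relu_netP t2; last by case: (relu_net0 t).
exists (Output (row_mx W W2) (b + b2)); split=> [|z1 z2] /=.
  by rewrite frobenius_sq_row.
by rewrite mul_row_col addrACA.
Qed.

(** The first layers read the same input and are stacked; the tails run in parallel. Depth at least
    2 matters: two output layers on one input would have to be merged by adding matrices, and the
    squared Frobenius norm is not subadditive. *)
Lemma sum_net L k (t1 t2 : relu_net R D L.+2 k) :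
  exists t : relu_net R D L.+2 k,
    weight_sq t = weight_sq t1 + weight_sq t2 /\
    forall z, realize t z = realize t1 z + realize t2 z.
Proof.
have [h1 [W1 [b1 [t1' ->]]]] := relu_netP t1.
have [h2 [W2 [b2 [t2' ->]]]] := relu_netP t2.
have [s [sw sE]] := parallel_net t1' t2'.
exists (Hidden (col_mx W1 W2) (col_mx b1 b2) s); split=> [|z] /=.
  by rewrite frobenius_sq_col sw addrACA.
by rewrite mul_col_mx add_col_mx relu_col sE.
Qed.

Lemma zero_net L k : exists t : relu_net R D L.+1 k,
  weight_sq t = 0 /\ forall z, realize t z = 0.
Proof.
elim: L k => [|L IH] k.
  exists (Output 0 0); split=> [|z] /=; first exact: frobenius_sq0.
  by rewrite mul0mx addr0.
(* The hidden layer has width 0. *)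
have [t [tw tE]] := IH 0.
exists (Hidden 0 0 t); split=> [|z] /=; last by rewrite tE.
by rewrite frobenius_sq0 tw addr0.
Qed.

End Networks.

(** * Transfer of inequalities to the lower semicontinuous regularization *)

Section LscRegularization.
Context (R : realType).

(** Solved for [K], the hypothesis exhibits [a^-1 * (G (h x) - b)] as a minorant of [K]; it is lower
    semicontinuous because [h] is continuous, so it stays below [lsc_reg K]. *)
Lemma lsc_reg_affine (S T : topologicalType) (K : S -> \bar R) (G : T -> \bar R)
    (h : S -> T) (a b : R) : 0 < a -> lsc G -> continuous h ->
  (forall x, G (h x) <= a%:E * K x + b%:E)%E ->
  forall x, (G (h x) <= a%:E * lsc_reg K x + b%:E)%E.
Proof.
move=> a0 lG hc GK x; rewrite -leeBlDr// -lee_pdivrMl//.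
apply: (lsc_reg_max (G := fun x => (a^-1%:E * (G (h x) - b%:E))%E)) => [c|y].
  rewrite (_ : [set _ | _] = h @^-1` [set y | (G y <= (a * c + b)%:E)%E]).
    by move/continuous_closedP: hc; apply; exact: lG.
  by apply/seteqP; split=> y; rewrite /preimage /mkset lee_pdivrMl// leeBlDr.
by rewrite lee_pdivrMl// leeBlDr.
Qed.

(** The step function with value 0 on [P] and [b] elsewhere is a lower semicontinuous minorant of
    [K], so [lsc_reg K] is at least [b] off [P]. *)
Lemma lsc_reg_lt_closed (T : topologicalType) (K : T -> \bar R) (P : set T) (b : R) :
  0 <= b -> closed P -> (forall x, 0 <= K x)%E ->
  (forall x, (K x < b%:E)%E -> P x) -> forall x, (lsc_reg K x < b%:E)%E -> P x.
Proof.
move=> b0 cP K0 KP x; apply: contraPP => Px; apply/negP; rewrite -leNgt.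
pose G y : \bar R := (if `[< P y >] then 0 else b)%:E.
have GK y : (G y <= K y)%E.
  rewrite /G; case: asboolP => [//|Py].
  by rewrite leNgt; apply/negP => /KP.
(* The sublevel set at [c] is everything if [b <= c], [P] if [0 <= c < b], and empty if [c < 0]. *)
have lG : lsc G.
  move=> c; have [bc|cb] := leP b c.
    rewrite (_ : [set _ | _] = setT); first exact: closedT.
    apply/seteqP; split=> y //= _; rewrite /G lee_fin.
    by case: ifP => // _; exact: le_trans bc.
  have [c0|c0] := leP 0 c.
    rewrite (_ : [set _ | _] = P)//; apply/seteqP; split=> y /=;
      rewrite /G lee_fin; case: asboolP => //.
    by rewrite leNgt cb.
  rewrite (_ : [set _ | _] = set0); first exact: closed0.
  apply/seteqP; split=> y //=; rewrite /G lee_fin.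
  by case: ifP => _; rewrite leNgt ?c0 ?cb.
by have := lsc_reg_max lG GK x; rewrite {1}/G asboolF.
Qed.

End LscRegularization.

(** * Continuity of sums and squares, and limits of Euclidean norms *)

Section RealContinuous.
Context (R : realType) (T : topologicalType).
Implicit Types u v : T -> R.

Lemma continuous_affine a b u : continuous u -> continuous (fun x => a * u x + b).
Proof.
move=> cu x; apply: cvgD; last exact: cvg_cst.
by apply: cvgM; [exact: cvg_cst|exact: cu].
Qed.

Lemma continuous_add u v : continuous u -> continuous v ->
  continuous (fun x => u x + v x).
Proof. by move=> cu cv x; apply: cvgD; [exact: cu|exact: cv]. Qed.

Lemma continuous_sum_sqr n (u v : 'I_n -> T -> R) :
  (forall j, continuous (u j)) -> (forall j, continuous (v j)) ->
  continuous (fun x => \sum_j (u j x - v j x) ^+ 2).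
Proof.
move=> cu cv; apply: continuous_big => [|j _ x]; first exact: add_continuous.
by apply: cvgM; (apply: cvgB; [exact: cu|exact: cv]).
Qed.

End RealContinuous.

Lemma enorm_coord (R : realType) n (v : 'cV[R]_n) j : `|v j 0| <= enorm v.
Proof.
rewrite -sqrtr_sqr ler_wsqrtr// (bigD1 j)//= lerDl.
by apply: sumr_ge0 => k _; rewrite sqr_ge0.
Qed.

(** Squared norms are polynomial in the coordinates, so they follow coordinatewise limits. *)
Lemma enorm_le_lim (R : realType) n (v : nat -> 'cV[R]_n) (w : 'cV[R]_n) c N :
  (forall j, v m j 0 @[m --> \oo] --> w j 0) ->
  (forall m, (N <= m)%N -> enorm (v m) <= c) -> enorm w <= c.
Proof.
move=> vw vc.
have c0 : 0 <= c by apply: le_trans (vc N (leqnn N)); exact: enorm_ge0.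
rewrite -(@ler_pXn2r _ 2) ?nnegrE ?enorm_ge0// sqr_enorm.
have H : \sum_j v m j 0 ^+ 2 @[m --> \oo] --> \sum_j w j 0 ^+ 2.
  apply: cvg_big => [|j _]; first exact: add_continuous.
  by apply: cvgM; exact: vw.
apply: (cvgr_to_le H); exists N => // m /= /vc.
by rewrite -sqr_enorm -(@ler_pXn2r _ 2) ?nnegrE ?enorm_ge0.
Qed.

(** * The weak* topology on Lipschitz maps *)

Section WeakStarTheory.
Context (R : realType) (d : nat) (X : set 'cV[R]_d) (e : X) (D : nat).
Local Notation T := (wstarLip e D).
Implicit Types (f g : Lip X D) (i : 'I_D * AE X + 'I_D).

Lemma Lip_lipschitz f :
  exists k, forall x y, enorm (f x - f y) <= k * enorm (val x - val y).
Proof. by have := lip_funP f; rewrite !inE. Qed.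

Lemma coord_lipschitz f k j :
  (forall x y, enorm (f x - f y) <= k * enorm (val x - val y)) ->
  forall x y, `|(f x j 0 - f e j 0) - (f y j 0 - f e j 0)| <= k * enorm (val x - val y).
Proof.
move=> fk x y; apply: le_trans (fk x y).
by have := enorm_coord (f x - f y) j; rewrite !mxE opprB addrA subrK.
Qed.

Lemma mol_pairing_lin (m : molecule X) a (g h : X -> R) :
  mol_pairing m (fun x => a * g x + h x) = a * mol_pairing m g + mol_pairing m h.
Proof.
rewrite /mol_pairing mulr_sumr -big_split; apply: eq_bigr => t _ /=; ring.
Qed.

Lemma wstar_eval_lin i a f g :
  wstar_eval e i (a *: f + g) = a * wstar_eval e i f + wstar_eval e i g.
Proof.
case: i => [[j m]|j] /=; last by rewrite !mxE.
have [kf fk] := Lip_lipschitz f; have [kg gk] := Lip_lipschitz g.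
have cf := is_cvg_ae_pairing (m := m) (coord_lipschitz j fk).
have cg := is_cvg_ae_pairing (m := m) (coord_lipschitz j gk).
rewrite /ae_pairing; apply: cvg_lim => //.
rewrite (_ : (fun n => _) = (fun n =>
    a * mol_pairing (m n) (fun x => f x j 0 - f e j 0) +
    mol_pairing (m n) (fun x => g x j 0 - g e j 0))).
  by apply: cvgD; [apply: cvgM; [exact: cvg_cst|exact: cf]|exact: cg].
apply/funext => n; rewrite -mol_pairing_lin; congr mol_pairing; apply/funext => x.
rewrite !mxE; ring.
Qed.

(** Universal property of a supremum of initial topologies. *)
Lemma wstar_cvg (F : set_system (Lip X D)) f : Filter F ->
  (forall i, wstar_eval e i @ F --> wstar_eval e i f) -> F --> (f : T).
Proof.
move=> FF H; apply/cvg_sup => i A [B [[W oW <-] Wf] sub].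
by apply: filterS sub _; apply: H; exact: open_nbhs_nbhs.
Qed.

Lemma wstar_eval_continuous i : continuous (wstar_eval e i : T -> R).
Proof.
move=> f A /(@initial_continuous _ _ (wstar_eval e i)).
by have /cvg_sup/(_ i) := @cvg_id _ (nbhs (f : T)); exact.
Qed.

(** Every evaluation of [a *: f + g] is an affine function of the same evaluation of [f]. *)
Lemma wstar_affine_continuous a g : continuous (fun f : T => (a *: f + g : T)).
Proof.
move=> f; have FF := fmap_filter (fun g' : T => (a *: g' + g : T)) (nbhs_filter (f : T)).
apply: (wstar_cvg FF) => i.
have H := @continuous_affine _ T a (wstar_eval e i g) _ (@wstar_eval_continuous i) f.
rewrite wstar_eval_lin => A /H.
apply: (@filterS T (nbhs (f : T)) (nbhs_filter (f : T))) => g' /=.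
by rewrite wstar_eval_lin.
Qed.

(** This constant sequence presents [delta_x - delta_e], which gives access to point values. *)
Lemma point_mol_cauchy x : ae_cauchy (fun=> [:: (1, x, e)] : molecule X).
Proof.
move=> eps eps0; exists 0%N => p q _ _; rewrite subrr.
suff : ae_norm (0 : X -> R) <= 0 by move/le_lt_trans; apply.
apply: ge_inf; first by exists 0 => _ [m _ <-]; apply: sumr_ge0 => t _;
  rewrite mulr_ge0 ?enorm_ge0.
exists [::]; last by rewrite /mol_cost big_nil.
by apply/funext => z; rewrite /mol_fun big_nil.
Qed.

(** A point value is the pairing with [delta_x - delta_e] plus the value at [e]. *)
Lemma coord_continuous x j : continuous (fun f : T => f x j 0).
Proof.
pose m := MkAE (point_mol_cauchy x).
have -> : (fun f : T => f x j 0) =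
    (fun f : T => wstar_eval e (inl (j, m)) f + wstar_eval e (inr j) f).
  apply/funext => f /=; rewrite /ae_pairing /= lim_cst//.
  by rewrite /mol_pairing big_seq1 mul1r subrr subr0 subrK.
by apply: (@continuous_add _ T); exact: wstar_eval_continuous.
Qed.

Lemma closed_enorm_le x y c : closed [set f : T | enorm (f x - f y) <= c].
Proof.
have [c0|c0] := leP 0 c; last first.
  rewrite (_ : [set _ | _] = set0); first exact: closed0.
  by apply/seteqP; split=> f //=; rewrite leNgt (lt_le_trans c0)// enorm_ge0.
pose N (f : T) := \sum_j (f x j 0 - f y j 0) ^+ 2.
rewrite (_ : [set _ | _] = N @^-1` [set r | r <= c ^+ 2]).
  apply: (preimage_closed _ (@closed_le _ _)) => f _.
  by apply: (@continuous_sum_sqr _ T _ (fun j f => f x j 0) (fun j f => f y j 0));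
    exact: coord_continuous.
have NE f : (enorm (f x - f y) <= c) = (N f <= c ^+ 2).
  rewrite -(@ler_pXn2r _ 2) ?nnegrE ?enorm_ge0// sqr_enorm.
  by congr (_ <= _); apply: eq_bigr => j _; rewrite !mxE.
by apply/seteqP; split=> f /=; rewrite NE.
Qed.

(** [C] bounds the Arens-Eells norm of [m]: from [N] on, the sequence stays within 1 of its term of
    index [N], whose norm is at most its cost. *)
Lemma ae_pairing_le (m : AE X) : exists C, 0 <= C /\ forall (g : X -> R) k, 0 < k ->
  (forall x y, `|g x - g y| <= k * enorm (val x - val y)) ->
  `|ae_pairing m g| <= k * C.
Proof.
have [N HN] := ae_seqP m ltr01.
have C0 : 0 <= mol_cost (m N).
  by apply: sumr_ge0 => t _; rewrite mulr_ge0 ?enorm_ge0.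
exists (1 + mol_cost (m N)); split=> [|g k k0 gk]; first by rewrite addr_ge0.
have cg := is_cvg_ae_pairing (m := m) gk.
rewrite /ae_pairing -lim_norm//; apply: limr_le; first exact: is_cvg_norm.
exists N => // n /= Nn; rewrite mulrDr -(subrK (mol_pairing (m N) g) (mol_pairing (m n) g)).
rewrite (le_trans (ler_normD _ _))// lerD ?mol_pairing_le//.
by rewrite ltW// mol_pairing_lt// HN.
Qed.

(** The hypothesis is convergence in the Lipschitz norm; [ae_pairing_le] turns it into convergence
    of each pairing. *)
Lemma wstar_cvg_lipschitz (u : nat -> Lip X D) f :
  (forall eps : R, 0 < eps -> exists N, forall n, (N <= n)%N ->
    (forall x y, enorm ((u n - f) x - (u n - f) y) <= eps * enorm (val x - val y)) /\
    enorm ((u n - f) e) <= eps) ->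
  (u n : T) @[n --> \oo] --> (f : T).
Proof.
move=> H; apply: wstar_cvg => i.
have E n : wstar_eval e i (u n) - wstar_eval e i f = wstar_eval e i (u n - f).
  by have := wstar_eval_lin i (-1) f (u n); rewrite scaleN1r mulN1r addrC => ->; rewrite addrC.
apply/cvgrPdist_le => eps eps0; case: i E => [[j m]|j] E.
  have [C [C0 HC]] := ae_pairing_le m.
  (* [C] may vanish, hence the divisor [C + 1]. *)
  have C1 : 0 < C + 1 by rewrite ltr_wpDl.
  have [N HN] := H _ (divr_gt0 eps0 C1).
  exists N => // n /= /HN[Hn _]; rewrite distrC -/(wstar_eval e (inl (j, m)) f) E /=.
  apply: le_trans (HC _ _ (divr_gt0 eps0 C1) (coord_lipschitz j Hn)) _.
  by rewrite mulrAC ler_pdivrMr// ler_pM2l// lerDl.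
have [N HN] := H _ eps0.
exists N => // n /= /HN[_ Hn]; rewrite distrC.
by have := enorm_coord ((u n - f) e) j; rewrite !mxE => /le_trans; exact.
Qed.

End WeakStarTheory.

(** * Homogeneity, subadditivity and Lipschitz control of the representation cost *)

Section RepresentationCostTheory.
Context (R : realType) (d : nat) (X : set 'cV[R]_d) (e : X) (D : nat).
Local Notation T := (wstarLip e D).
Implicit Types (f g : Lip X D) (L : nat).

Lemma RTheta_le L f (t : relu_net R D L d) :
  (fun x : X => realize t (val x)) = f -> (RTheta L f <= (param_cost t)%:E)%E.
Proof. by move=> tf; apply: ereal_inf_lbound; exists t. Qed.

Lemma RTheta_ge0 L f : (0 <= RTheta L f)%E.
Proof.
by apply: le_ereal_inf_tmp => _ [t _ <-]; rewrite lee_fin param_cost_ge0.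
Qed.

Lemma RL_le_RTheta L f : (RL e L f <= RTheta L f)%E.
Proof. exact: lsc_reg_le. Qed.

Lemma lsc_RL L : lsc (RL e L : T -> \bar R).
Proof. exact: lsc_lsc_reg. Qed.

Lemma RTheta_opp L f : (RTheta L (- f)%R <= RTheta L f)%E.
Proof.
apply: le_ereal_inf_tmp => _ [t tf <-].
rewrite /param_cost -weight_sq_opp; apply: RTheta_le.
by apply/funext => x; rewrite realize_opp; have /(congr1 (@^~ x)) /= -> := tf.
Qed.

Lemma RTheta_scale L c f : 0 < c ->
  (RTheta L (c ^+ L *: f)%R <= (c ^+ 2)%R%:E * RTheta L f)%E.
Proof.
move=> c0; rewrite -lee_pdivrMl ?exprn_gt0//.
apply: le_ereal_inf_tmp => _ [t tf <-].
rewrite lee_pdivrMl ?exprn_gt0// -EFinM /param_cost mulrCA.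
rewrite -(weight_sq_scale c 1); apply: RTheta_le.
apply/funext => x; rewrite -[val x]scale1r realize_scale ?ltW// mulr1.
by have /(congr1 (@^~ x)) /= -> := tf.
Qed.

(** One summand is a given network, so that its cost is a real number, as the shift in
    [lsc_reg_affine] must be. *)
Lemma RTheta_add L f g (t : relu_net R D L.+2 d) :
  (fun x : X => realize t (val x)) = g ->
  (RTheta L.+2 (f + g)%R <= RTheta L.+2 f + (param_cost t)%:E)%E.
Proof.
move=> tg; rewrite -leeBlDr//; apply: le_ereal_inf_tmp => _ [s sf <-].
rewrite leeBlDr// -EFinD; have [r [rw rE]] := sum_net s t.
rewrite /param_cost -mulrDr -rw; apply: RTheta_le.
apply/funext => x; rewrite rE.
by have /(congr1 (@^~ x)) /= -> := sf; have /(congr1 (@^~ x)) /= -> := tg.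
Qed.

Lemma RL0 L : RL e L.+1 (0 : Lip X D) = 0%E.
Proof.
apply/eqP; rewrite eq_le RL_ge0 andbT (le_trans (RL_le_RTheta _ _))//.
have [t [tw tE]] := zero_net R D L d.
rewrite (_ : 0%E = (param_cost t)%:E); last by rewrite /param_cost tw mulr0.
by apply: RTheta_le; apply/funext => x; rewrite tE.
Qed.

Lemma RL_opp L f : RL e L (- f) = RL e L f.
Proof.
suff H g : (RL e L (- g)%R <= RL e L g)%E.
  by apply/eqP; rewrite eq_le H/= -{1}[f]opprK.
have hc : continuous (fun g : T => (- g : T)).
  rewrite (_ : (fun g : T => _) = (fun g : T => (-1 *: g + 0 : T))).
    exact: wstar_affine_continuous.
  by apply/funext => h; rewrite scaleN1r addr0.
have := @lsc_reg_affine R T T (RTheta L) _ _ 1 0 ltr01 (@lsc_RL L) hc _ g.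
rewrite mul1e adde0; apply => h.
by rewrite mul1e adde0 (le_trans (RL_le_RTheta _ _))// RTheta_opp.
Qed.

Lemma RL_scale_le L c f : 0 < c ->
  (RL e L (c ^+ L *: f)%R <= (c ^+ 2)%R%:E * RL e L f)%E.
Proof.
move=> c0; have hc : continuous (fun g : T => (c ^+ L *: g : T)).
  rewrite (_ : (fun g : T => _) = (fun g : T => (c ^+ L *: g + 0 : T))).
    exact: wstar_affine_continuous.
  by apply/funext => h; rewrite addr0.
have c20 : 0 < c ^+ 2 by rewrite exprn_gt0.
have := @lsc_reg_affine R T T (RTheta L) _ _ _ 0 c20 (@lsc_RL L) hc _ f.
rewrite adde0; apply => h.
by rewrite adde0 (le_trans (RL_le_RTheta _ _))// RTheta_scale.
Qed.

Lemma RL_scale L c f : 0 < c ->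
  RL e L (c ^+ L *: f) = ((c ^+ 2)%R%:E * RL e L f)%E.
Proof.
move=> c0; apply/eqP; rewrite eq_le RL_scale_le//=.
rewrite -lee_pdivlMl ?exprn_gt0// -exprVn.
(* The reverse inequality is the same bound for the inverse factor. *)
have := @RL_scale_le L c^-1 (c ^+ L *: f).
by rewrite scalerA -exprMn mulVf ?gt_eqF// expr1n scale1r invr_gt0; apply.
Qed.

(* Lower semicontinuity in one variable at a time: first [RTheta f] is replaced
   by [RL f] with [g] a network, then [RTheta g] by [RL g] with [f] fixed. *)
Lemma RL_add L f g : (RL e L.+2 f < +oo)%E ->
  (RL e L.+2 (f + g)%R <= RL e L.+2 f + RL e L.+2 g)%E.
Proof.
move=> foo; have step1 (t : relu_net R D L.+2 d) f' g' :
    (fun x : X => realize t (val x)) = g' ->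
    (RL e L.+2 (f' + g')%R <= RL e L.+2 f' + (param_cost t)%:E)%E.
  move=> tg; have hc : continuous (fun h : T => (h + g' : T)).
    rewrite (_ : (fun h : T => _) = (fun h : T => (1 *: h + g' : T))).
      exact: wstar_affine_continuous.
    by apply/funext => h; rewrite scale1r.
  have := @lsc_reg_affine R T T (RTheta L.+2) _ _ 1 (param_cost t) ltr01
    (@lsc_RL L.+2) hc _ f'.
  rewrite mul1e; apply => h.
  by rewrite mul1e (le_trans (RL_le_RTheta _ _))// RTheta_add.
have fE : RL e L.+2 f = (fine (RL e L.+2 f))%:E.
  by rewrite fineK// ge0_fin_numE ?RL_ge0.
have hc : continuous (fun h : T => (f + h : T)).
  rewrite (_ : (fun h : T => _) = (fun h : T => (1 *: h + f : T))).
    exact: wstar_affine_continuous.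
  by apply/funext => h; rewrite scale1r addrC.
have := @lsc_reg_affine R T T (RTheta L.+2) _ _ 1 (fine (RL e L.+2 f)) ltr01
  (@lsc_RL L.+2) hc _ g.
rewrite mul1e -fE addeC; apply => h.
rewrite mul1e fE -leeBlDr//; apply: le_ereal_inf_tmp => _ [t tg <-].
by rewrite leeBlDr// addeC -fE step1.
Qed.

(** For fixed [x] and [y] the bound cuts out a weak* closed set. It contains every network of cost
    below [b], as [weight_sq] is [L.+1] times the cost, and [lsc_reg_lt_closed] extends this to
    [RL]. *)
Lemma RL_lipschitz L f b : 0 <= b -> (RL e L.+1 f < b%:E)%E -> forall x y,
  enorm (f x - f y) <= Num.sqrt (L.+1%:R * b) ^+ L.+1 * enorm (val x - val y).
Proof.
move=> b0 fb x y; set c := (leRHS).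
have := @lsc_reg_lt_closed R T (RTheta L.+1) _ b b0
  (@closed_enorm_le R d X e D x y c) (@RTheta_ge0 L.+1) _ f fb.
apply => g /ereal_inf_lt[_ [t tg <-]]; rewrite lte_fin => tb /=.
have /(congr1 (@^~ x)) /= <- := tg; have /(congr1 (@^~ y)) /= <- := tg.
apply: le_trans (realize_lipschitz _ _ _) _.
rewrite /c ler_wpM2r ?enorm_ge0// lerXn2r ?nnegrE ?sqrtr_ge0// ler_wsqrtr//.
by rewrite -ler_pdivrMl ?ltr0n// ltW.
Qed.

End RepresentationCostTheory.

(** * Powers with exponent at most 1, and the quasi-triangle inequality *)

Section QuasiNormTheory.
Context (R : realType).

(** For positive [x] and [y], the fractions [x / (x + y)] and [y / (x + y)] add up to 1, and a
    number in (0, 1] is at most its power of exponent [p]. *)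
Lemma powRD_le (p x y : R) : 0 < p <= 1 -> 0 <= x -> 0 <= y ->
  (x + y) `^ p <= x `^ p + y `^ p.
Proof.
move=> /andP[p0 p1] x0 y0.
have [->|xn0] := eqVneq x 0.
  by rewrite powR0 ?gt_eqF// !add0r.
have [->|yn0] := eqVneq y 0.
  by rewrite (powR0 (lt0r_neq0 p0)) !addr0.
have xp : 0 < x by rewrite lt0r xn0.
have yp : 0 < y by rewrite lt0r yn0.
have s0 : 0 < x + y by rewrite addr_gt0.
have H (z : R) : 0 < z -> z <= x + y -> z / (x + y) * (x + y) `^ p <= z `^ p.
  move=> z0 zs; have t0 : 0 < z / (x + y) by rewrite divr_gt0.
  have -> : z `^ p = (z / (x + y)) `^ p * (x + y) `^ p.
    by rewrite -powRM ?ltW// divfK ?gt_eqF.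
  rewrite ler_wpM2r ?powR_ge0// ger1_powR// t0 /=.
  by rewrite ler_pdivrMr// mul1r.
have Hx : x <= x + y by rewrite lerDl.
have Hy : y <= x + y by rewrite lerDr.
apply: le_trans (lerD (H x xp Hx) (H y yp Hy)).
by rewrite -mulrDl -mulrDl divff ?gt_eqF// mul1r.
Qed.

Lemma p_seminormP (E : lmodType R) (V : set E) (Q : E -> R) (p : R) :
  0 < p <= 1 -> submod_closed (mem V) -> (forall f, V f -> 0 <= Q f) ->
  (forall a f, V f -> Q (a *: f) = `|a| * Q f) ->
  (forall f g, V f -> V g -> Q (f + g) `^ p <= Q f `^ p + Q g `^ p) ->
  p_seminorm p V Q.
Proof.
move=> /[dup] p01 /andP[p0 p1] sV Q0 QZ QD; split=> //; split=> //.
(* Bounding both [Q f] and [Q g] by their sum costs a factor 2 inside the power [p]; the constant is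
   its root of order [p]. *)
exists (2 `^ p^-1) => f g Vf Vg.
have VD : V (f + g).
  by have [_ /(_ 1 f g)] := sV; rewrite scale1r !inE; apply.
have K (z : R) : 0 <= z -> (z `^ p) `^ p^-1 = z.
  by move=> z0; rewrite -powRrM divff ?gt_eqF// powRr1.
rewrite -(K _ (Q0 _ VD)) -(K (Q f + Q g)) ?addr_ge0 ?Q0// -powRM ?powR_ge0//.
rewrite ge0_ler_powR ?nnegrE ?mulr_ge0 ?powR_ge0 ?invr_ge0 ?(ltW p0)//.
apply: le_trans (QD _ _ Vf Vg) _; rewrite mulr_natl mulr2n.
by rewrite lerD// ge0_ler_powR ?nnegrE ?addr_ge0 ?Q0 ?(ltW p0)// ?lerDl ?lerDr ?Q0.
Qed.

End QuasiNormTheory.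

(** * The native space: seminorm, norm and completeness *)

Section NativeSpace.
Context (R : realType) (d D : nat) (X : set 'cV[R]_d) (e : X) (L : nat).
Local Notation T := (wstarLip e D).
Local Notation V := (native_space e D L.+2).
Local Notation Q := (RL_pow e L.+2).
Local Notation N := (native_norm e L.+2).
Local Notation p := (2 / L.+2%:R : R).
Implicit Types f g : Lip X D.

Let Lp : 0 < L.+2%:R :> R. Proof. by rewrite ltr0n. Qed.

Let p01 : 0 < p <= 1.
Proof. by rewrite divr_gt0//= ler_pdivrMr// mul1r ler_nat. Qed.

Let q0 : 0 < L.+2%:R / 2 :> R.
Proof. by rewrite divr_gt0. Qed.

Let pq : L.+2%:R / 2 * p = 1.
Proof. by rewrite mulrA divfK// divff ?gt_eqF. Qed.

Lemma RL_fineK f : V f -> (fine (RL e L.+2 f))%:E = RL e L.+2 f.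
Proof. by move=> Vf; rewrite fineK// ge0_fin_numE ?RL_ge0. Qed.

(** Reduces the [p]-triangle inequality for [Q] to subadditivity of [RL]. *)
Lemma RL_powK f : Q f `^ p = fine (RL e L.+2 f).
Proof. by rewrite -powRrM pq powRr1// fine_ge0// RL_ge0. Qed.

(** [RL_scale] is used with the root of order [L.+2] of the absolute value of [a]; [RL_opp] handles
    the sign. *)
Lemma RL_scale_norm a f : a != 0 ->
  RL e L.+2 (a *: f) = (((`|a| `^ L.+2%:R^-1) ^+ 2)%R%:E * RL e L.+2 f)%E.
Proof.
move=> a0; have na0 : 0 < `|a| by rewrite normr_gt0.
have cE : (`|a| `^ L.+2%:R^-1) ^+ L.+2 = `|a|.
  by rewrite -powR_mulrn ?powR_ge0// -powRrM mulVf ?gt_eqF// powRr1.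
rewrite -RL_scale ?powR_gt0// cE.
by have [_|_] := ger0P a; rewrite // scaleNr RL_opp.
Qed.

Lemma native_space_scale a f : V f -> V (a *: f).
Proof.
move=> Vf; rewrite /native_space /=.
have [->|a0] := eqVneq a 0; first by rewrite scale0r RL0.
by rewrite RL_scale_norm// -RL_fineK// -EFinM ltry.
Qed.

Lemma native_space_add f g : V f -> V g -> V (f + g).
Proof.
move=> Vf Vg; apply: le_lt_trans (RL_add _ Vf) _.
exact: lte_add_pinfty.
Qed.

Lemma native_submod_closed : submod_closed (mem V).
Proof.
split=> [|a f g]; rewrite !inE; first by rewrite /native_space /= RL0.
by move=> Vf Vg; apply: native_space_add => //; exact: native_space_scale.
Qed.

Lemma native_space_sub f g : V f -> V g -> V (f - g).
Proof.
by move=> Vf Vg; rewrite -scaleN1r; apply: native_space_add => //;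
  exact: native_space_scale.
Qed.

Lemma RL_powZ a f : V f -> Q (a *: f) = `|a| * Q f.
Proof.
move=> Vf; rewrite /RL_pow; have [->|a0] := eqVneq a 0.
  by rewrite scale0r RL0 normr0 mul0r powR0// gt_eqF.
rewrite RL_scale_norm// -RL_fineK// -EFinM /=.
rewrite powRM ?exprn_ge0 ?powR_ge0 ?fine_ge0 ?RL_ge0//; congr (_ * _).
rewrite -powR_mulrn ?powR_ge0// -!powRrM [2%:R * _]mulrC divfK ?pnatr_eq0//.
by rewrite mulVf ?gt_eqF// powRr1.
Qed.

Lemma RL_powD f g : V f -> V g -> Q (f + g) `^ p <= Q f `^ p + Q g `^ p.
Proof.
move=> Vf Vg; rewrite !RL_powK -lee_fin EFinD !RL_fineK//.
  exact: RL_add.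
exact: native_space_add.
Qed.

Lemma native_norm_ge0 f : 0 <= N f.
Proof. by rewrite le_max powR_ge0. Qed.

Lemma native_normZ a f : V f -> N (a *: f) = `|a| * N f.
Proof. by move=> Vf; rewrite /native_norm RL_powZ// enormZ maxr_pMr. Qed.

Lemma native_normD f g : V f -> V g -> N (f + g) `^ p <= N f `^ p + N g `^ p.
Proof.
have [p0 _] := andP p01.
have mono (x y : R) : 0 <= x -> x <= y -> x `^ p <= y `^ p.
  by move=> x0 xy; rewrite ge0_ler_powR ?nnegrE ?(ltW p0) ?(le_trans x0 xy).
(* Whichever term attains the maximum at [f + g] satisfies the [p]-triangle inequality, the value at
   [e] by [powRD_le]. *)
move=> Vf Vg; rewrite /native_norm; case: (leP (Q (f + g))) => _.
  apply: le_trans (mono _ _ (enorm_ge0 _) (enormD _ _)) _.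
  apply: le_trans (powRD_le p01 (enorm_ge0 _) (enorm_ge0 _)) _.
  by apply: lerD; apply: mono; rewrite ?enorm_ge0// le_max lexx orbT.
apply: le_trans (RL_powD Vf Vg) _.
by apply: lerD; apply: mono; rewrite ?powR_ge0// le_max lexx.
Qed.

Lemma RL_pow_seminorm : p_seminorm p V Q.
Proof.
apply: p_seminormP => //; first exact: native_submod_closed.
- by move=> f _; exact: powR_ge0.
- by move=> a f; exact: RL_powZ.
- exact: RL_powD.
Qed.

Lemma native_norm_seminorm : p_seminorm p V N.
Proof.
apply: p_seminormP => //; first exact: native_submod_closed.
- by move=> f _; exact: native_norm_ge0.
- by move=> a f; exact: native_normZ.
- exact: native_normD.
Qed.

Lemma RL_small (eps : R) : 0 < eps -> exists2 b, 0 < b &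
  forall f, (RL e L.+2 f < b%:E)%E -> forall x y,
    enorm (f x - f y) <= eps * enorm (val x - val y).
Proof.
move=> eps0; pose c := eps `^ L.+2%:R^-1.
have c0 : 0 < c by exact: powR_gt0.
(* This [b] makes the constant of [RL_lipschitz] equal to [eps]. *)
exists (c ^+ 2 / L.+2%:R) => [|f fb x y]; first by rewrite divr_gt0 ?exprn_gt0.
apply: le_trans (RL_lipschitz _ fb x y) _.
  by rewrite divr_ge0 ?exprn_ge0 ?ltW.
rewrite [L.+2%:R * _]mulrC divfK ?gt_eqF// sqrtr_sqr ger0_norm ?(ltW c0)//.
by rewrite -powR_mulrn ?powR_ge0// -powRrM mulVf ?gt_eqF// powRr1 ?(ltW eps0)//.
Qed.

Lemma RL_pow_lt b f : 0 < b -> V f ->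
  (Q f < b `^ (L.+2%:R / 2)) = (RL e L.+2 f < b%:E)%E.
Proof.
move=> b0 Vf; rewrite -RL_fineK// lte_fin /RL_pow; apply/idP/idP.
  apply: contraTT; rewrite -!leNgt => bf.
  by rewrite ge0_ler_powR ?nnegrE ?fine_ge0 ?RL_ge0 ?(ltW q0) ?(ltW b0).
by apply: gt0_ltr_powR; rewrite ?nnegrE ?fine_ge0 ?RL_ge0 ?(ltW b0).
Qed.

(** Such an [f] vanishes at [e] and has every positive number as a Lipschitz constant. *)
Lemma native_norm_eq0 f : V f -> N f = 0 -> f = 0.
Proof.
move=> Vf Nf0.
have Qf0 : Q f = 0.
  by apply/eqP; rewrite eq_le powR_ge0 andbT -Nf0 le_max lexx.
have fe0 : f e = 0.
  apply: enorm0_eq0; apply/eqP.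
  by rewrite eq_le enorm_ge0 andbT -Nf0 le_max lexx orbT.
have RLf0 : RL e L.+2 f = 0%E.
  have /andP[p0 _] := p01.
  by rewrite -RL_fineK// -RL_powK Qf0 powR0// gt_eqF.
have fx x : f x = 0.
  apply: enorm0_eq0; apply/eqP; rewrite eq_le enorm_ge0 andbT.
  apply/ler_addgt0Pr => eps eps0; rewrite add0r.
  (* The [+ 1] keeps the divisor positive when [x] is [e]. *)
  have z0 : 0 < enorm (val x - val e) + 1 by rewrite ltr_wpDl ?enorm_ge0.
  have [b b0 /(_ f)] := RL_small (divr_gt0 eps0 z0).
  rewrite RLf0 lte_fin => /(_ b0 x e); rewrite fe0 subr0 => /le_trans; apply.
  by rewrite mulrAC ler_pdivrMr// ler_pM2l// lerDl.
by apply: val_inj; apply/funext => x; rewrite /= fx.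
Qed.

Lemma native_norm_quasi_norm : quasi_norm V N.
Proof.
by split=> [|f]; [have [] := native_norm_seminorm|exact: native_norm_eq0].
Qed.

(** Completeness for the Lipschitz norm: the limit is taken pointwise, and the Cauchy bounds pass to
    it. *)
Lemma Lip_limit (u : nat -> Lip X D) :
  (forall eps : R, 0 < eps -> exists M, forall m n, (M <= m)%N -> (M <= n)%N ->
    (forall x y, enorm ((u m - u n) x - (u m - u n) y) <= eps * enorm (val x - val y)) /\
    enorm ((u m - u n) e) <= eps) ->
  exists f, forall eps : R, 0 < eps -> exists M, forall n, (M <= n)%N ->
    (forall x y, enorm ((u n - f) x - (u n - f) y) <= eps * enorm (val x - val y)) /\
    enorm ((u n - f) e) <= eps.
Proof.
move=> uC.
have cu x j : cvgn (fun n => u n x j 0).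
  apply: cauchy_cvg; apply/cauchy_exP => eps eps0.
  (* One unit of the 2 absorbs the bound at [e], the other makes the estimate strict. *)
  pose C := enorm (val x - val e) + 2.
  have C0 : 0 < C by rewrite ltr_wpDl ?enorm_ge0.
  have [M HM] := uC _ (divr_gt0 eps0 C0).
  exists (u M x j 0); exists M => // n /= Mn.
  have [H1 H2] := HM M n (leqnn _) Mn.
  have := enorm_coord ((u M - u n) x) j; rewrite [in X in `|X|]mxE mxE => /le_lt_trans; apply.
  rewrite -[(u M - u n) x](subrK ((u M - u n) e)).
  apply: le_lt_trans (enormD _ _) _; apply: le_lt_trans (lerD (H1 _ _) H2) _.
  rewrite -[X in _ + X]mulr1 -mulrDr mulrAC ltr_pdivrMr//.
  by rewrite ltr_pM2l// ltrD2l ltr1n.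
have [F uF] : exists F : X -> 'cV[R]_D,
    forall x j, u n x j 0 @[n --> \oo] --> F x j 0.
  by exists (fun x => \col_j limn (fun n => u n x j 0)) => x j; rewrite mxE; exact: cu.
have F1 (eps : R) : 0 < eps -> exists M, forall n, (M <= n)%N ->
    (forall x y, enorm ((u n x - F x) - (u n y - F y)) <= eps * enorm (val x - val y)) /\
    enorm (u n e - F e) <= eps.
  move=> /uC[M HM]; exists M => n Mn; split=> [x y|].
    apply: (@enorm_le_lim _ _ (fun m => (u n - u m) x - (u n - u m) y) _ _ M) => [j|m Mm].
      under eq_fun do rewrite !mxE.
      by rewrite !mxE; apply: cvgB; (apply: cvgB; [exact: cvg_cst|exact: uF]).
    by have [] := HM n m Mn Mm.
  apply: (@enorm_le_lim _ _ (fun m => (u n - u m) e) _ _ M) => [j|m Mm].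
    under eq_fun do rewrite !mxE.
    by rewrite !mxE; apply: cvgB; [exact: cvg_cst|exact: uF].
  by have [] := HM n m Mn Mm.
have Flip : F \in @lipschitz_pred R d X D.
  have [M /(_ M (leqnn _)) [HM _]] := F1 _ ltr01.
  have [k uk] := Lip_lipschitz (u M).
  rewrite !inE; exists (k + 1) => x y.
  (* [F] is [u M] minus [u M - F], and 1 is a Lipschitz constant of the latter. *)
  rewrite (_ : F x - F y = (u M x - u M y) - ((u M x - F x) - (u M y - F y))); last first.
    by apply/matrixP => i j; rewrite !mxE; ring.
  rewrite mulrDl (le_trans (enormD _ _))// lerD//.
  by rewrite -scaleN1r enormZ normrN1 mul1r.
by exists (MkLip Flip).
Qed.

Lemma native_space_complete : quasi_complete V N.
Proof.
move=> u Vu uC.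
have uC' (eps : R) : 0 < eps -> exists M, forall m n, (M <= m)%N -> (M <= n)%N ->
    (RL e L.+2 (u m - u n)%R < eps%:E)%E /\ enorm ((u m - u n) e) < eps.
  move=> eps0; have eq0 : 0 < eps `^ (L.+2%:R / 2) by exact: powR_gt0.
  (* The first threshold controls the value at [e]; the second, a power of [eps], controls [RL]. *)
  have [M1 H1] := uC _ eps0; have [M2 H2] := uC _ eq0.
  exists (maxn M1 M2) => m n; rewrite !geq_max => /andP[m1 m2] /andP[n1 n2].
  have := H1 m n m1 n1; rewrite gt_max => /andP[_ ->]; split=> //.
  have := H2 m n m2 n2; rewrite gt_max => /andP[+ _].
  by rewrite RL_pow_lt//; exact: native_space_sub.
have [eps eps0|f uf] := @Lip_limit u.
  have [b b0 Hb] := RL_small eps0.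
  have m0 : 0 < Num.min b eps by rewrite lt_min b0.
  have [M HM] := uC' _ m0; exists M => m n Mm Mn.
  have [H1 H2] := HM m n Mm Mn; split; last first.
    by rewrite ltW// (lt_le_trans H2)// ge_min lexx orbT.
  by apply: Hb; rewrite (lt_le_trans H1)// lee_fin ge_min lexx.
have ufw : (u n : T) @[n --> \oo] --> (f : T) by exact: wstar_cvg_lipschitz.
have RLuf (eps : R) : 0 < eps -> exists M, forall n, (M <= n)%N ->
    (RL e L.+2 (u n - f)%R <= eps%:E)%E.
  move=> /uC'[M HM]; exists M => n Mn.
  (* Subtraction from the fixed [u n] is weak* continuous. *)
  have H : (u n - u m : T) @[m --> \oo] --> (u n - f : T).
    have := @wstar_affine_continuous _ _ _ e D (-1) (u n) f.
    move=> /(cvg_comp _ _ ufw).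
    rewrite scaleN1r addrC (_ : _ \o _ = (fun m => u n - u m : T))//.
    by apply/funext => m /=; rewrite scaleN1r addrC.
  apply: (closed_cvg (fun g : T => (RL e L.+2 g <= eps%:E)%E) _ _ _ H).
    exact: lsc_RL.
  by exists M => // m /= Mm; have [/ltW] := HM n m Mn Mm.
(* [f] is the difference of [u M] and [u M - f], both in [V]. *)
have Vf : V f.
  have [M /(_ M (leqnn M)) HM] := RLuf _ ltr01.
  have : V (u M - f) by apply: le_lt_trans HM _; exact: ltry.
  by move=> /(native_space_sub (Vu M)); rewrite subKr.
exists f => //; apply/cvgr0Pnorm_le => eps eps0.
(* The bound on [RL] that corresponds to the bound [eps] on [Q]. *)
have ep0 : 0 < eps `^ p by exact: powR_gt0.
have [M1 H1] := RLuf _ ep0; have [M2 H2] := uf _ eps0.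
exists (maxn M1 M2) => // n /=; rewrite geq_max => /andP[n1 n2].
rewrite ger0_norm ?native_norm_ge0// /native_norm ge_max (H2 n n2).2 andbT.
have Vn : V (u n - f) by exact: native_space_sub.
have := H1 n n1; rewrite -RL_fineK// lee_fin /RL_pow => H.
have -> : eps = (eps `^ p) `^ (L.+2%:R / 2).
  by rewrite -powRrM mulrC pq powRr1// ltW.
by rewrite ge0_ler_powR ?nnegrE ?fine_ge0 ?RL_ge0 ?powR_ge0 ?(ltW q0).
Qed.

End NativeSpace.

Theorem theorem9p3 (R : realType) (d D : nat) (hd : (1 <= d)%N) (hD : (1 <= D)%N)
    (X : set 'cV[R]_d) (e : X) (L : nat) (hL : (2 <= L)%N) :
  p_seminorm (2 / L%:R) (native_space e D L) (RL_pow e L) /\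
  (p_norm (2 / L%:R) (native_space e D L) (native_norm e L) /\
   quasi_Banach (native_space e D L) (native_norm e L)).
Proof.
case: L hL => [//|[//|L]] _.
split; first exact: RL_pow_seminorm.
split; split; [exact: native_norm_seminorm|exact: native_norm_quasi_norm..|].
exact: native_space_complete.
Qed.
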